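(* Let $(\mathfrak h,(H_i,L_i)_{i\in I})$ be a linear Coxeter system with linear Coxeter group $\mathcal W$, closed fundamental chamber $\overline C$ and Tits cone $X$. Let $Y\subseteq X$ be a $\mathcal W$-invariant convex subcone containing $0$, and let $R'\in\mathrm{Fa}(Y)$. Then there exist $\sigma\in\mathcal W$ and a uniquely determined $R\in\Upsilon$ such that $R'=\sigma R$.
   Context: $\mathbb R^+=(0,\infty)$. A convex cone is a subset of a real vector space closed under addition and under multiplication by elements of $\mathbb R^+$. $\mathrm{ri}$ denotes the relative interior of a finite-dimensional convex set. For a convex cone $K$ containing $0$, a face of $K$ is a convex cone $F\subseteq K$ with $(K\setminus F)+K\subseteq K\setminus F$; $\mathrm{Fa}(K)$ is the set of nonempty faces, ordered by inclusion. Linear Coxeter systems. Let $\mathfrak h$ be a finite-dimensional real vector space, $n\ge1$, $I=\{1,\dots,n\}$. For a zero-based closed ray $H\subseteq\mathfrak h$ put $H^{\ge0}=\{\lambda\in\mathfrak h^*\mid\lambda(h)\ge0\ \forall h\in H\}$, $H^{>0}=\{\lambda\mid\lambda(h)>0\ \forall h\in H\setminus\{0\}\}$, $H^{=0}=\{\lambda\mid\lambda(h)=0\ \forall h\in H\}$. A linear Coxeter system $(\mathfrak h,(H_i,L_i)_{i\in I})$ consists of zero-based closed rays $H_i\subseteq\mathfrak h$, $L_i\subseteq\mathfrak h^*$ with $L_i\setminus\{0\}\subseteq H_i^{>0}$ such that: (1) the closed fundamental chamber $\overline C=\bigcap_{i\in I}H_i^{\ge0}$ spans $\mathfrak h^*$,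 and $\overline C\cap H_i^{=0}$, $i\in I$, are its pairwise different faces of codimension 1; (2) with $C=\bigcap_{i\in I}H_i^{>0}$ and $\mathcal W$ (the linear Coxeter group) the group generated by the reflections $\sigma_i$ on $\mathfrak h^*$ at the hyperplane $H_i^{=0}$ along the line $L_i\cup(-L_i)$, one has $\sigma C\cap C=\emptyset$ for all $\sigma\in\mathcal W\setminus\{1\}$. The Tits cone is the convex cone $X=\bigcup_{\sigma\in\mathcal W}\sigma\overline C$. $\Upsilon=\{R\in\mathrm{Fa}(Y)\mid\mathrm{ri}(R)\cap\overline C\ne\emptyset\}$. *)

(* Defs.v *)
From HB Require Import structures.
From mathcomp Require Import all_boot all_order all_algebra.
From mathcomp Require Import all_classical all_reals all_analysis.

Set Implicit Arguments.
Unset Strict Implicit.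
Unset Printing Implicit Defensive.

Import Order.TTheory GRing.Theory Num.Theory.
Import numFieldNormedType.Exports.

Local Open Scope classical_set_scope.
Local Open Scope ring_scope.

Section RealVectorSpace.
Variables (R : realType) (V : vectType R).
Implicit Types (A K F : set V) (U : {vspace V}) (G S : set 'End(V)).

Definition cone K : Prop :=
  (forall x y, K x -> K y -> K (x + y)) /\
  (forall (a : R) x, 0 < a -> K x -> K (a *: x)).

(* Faces in Fa(K) are nonempty; this matters, as the empty set satisfies all
   the other conditions. *)
Definition Fa K : set (set V) :=
  [set F | [/\ cone F, F `<=` K,
    [set x + y | x in K `\` F & y in K] `<=` K `\` F & F !=set0]].

Definition ray A : Prop :=
  exists2 v : V, v != 0 & A = [set a *: v | a in [set a : R | 0 <= a]].

Definition is_span A U : Prop :=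
  (forall x, A x -> x \in U) /\
  (forall U', (forall x, A x -> x \in U') -> (U <= U')%VS).

(* All nonempty faces of a cone containing 0 contain 0, so that dimensions are
   those of linear spans. *)
Definition codim1_face K F : Prop :=
  Fa K F /\ exists UF UK : {vspace V},
    [/\ is_span F UF, is_span K UK & (\dim UF).+1 = \dim UK].

Definition affine_set A : Prop :=
  forall (a : R) x y, A x -> A y -> A ((1 - a) *: x + a *: y).

Definition affine_hull A : set V := smallest affine_set A.

(* The canonical topology of a finite-dimensional real vector space, obtained
   from an arbitrary basis. *)
Definition coords (v : V) : 'rV[R]_(\dim {:V}) :=
  \row_i coord (vbasis {:V}) i v.

Definition ri A : set V :=
  [set x | A x /\
    within (affine_hull A) (nbhs (x : initial_topology coords)) A].

(* The last condition makes the elements of G invertible (equal source and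
   target), so that f^-1 is the two-sided inverse. *)
Definition lin_group G : Prop :=
  [/\ G \1%VF,
      (forall f g, G f -> G g -> G (f \o g)%VF),
      (forall f, G f -> G (f^-1)%VF) &
      (forall f, G f -> lker f == 0%VS)].

Definition generated_group S : set 'End(V) := smallest lin_group S.

Definition reflection_at (s : 'End(V)) (Hyp Line : set V) : Prop :=
  (forall x, Hyp x -> s x = x) /\ (forall x, Line x -> s x = - x).

End RealVectorSpace.

Section LinearCoxeter.
Variables (R : realType) (h : vectType R).
Local Notation hdual := 'Hom(h, R^o).

Definition ge0_on (H : set h) : set hdual :=
  [set l : hdual | forall x, H x -> 0 <= (l x : R)].
Definition gt0_on (H : set h) : set hdual :=
  [set l : hdual | forall x, H x -> x != 0 -> 0 < (l x : R)].
Definition eq0_on (H : set h) : set hdual :=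
  [set l : hdual | forall x, H x -> l x = 0].

Variables (n : nat) (H : 'I_n -> set h) (L : 'I_n -> set hdual).

Definition closed_chamber : set hdual := \bigcap_i ge0_on (H i).
Definition chamber : set hdual := \bigcap_i gt0_on (H i).

(* As L_i \ {0} avoids the hyperplane H_i^{=0}, reflection_at determines
   sigma_i uniquely. *)
Definition coxeter_group : set 'End(hdual) :=
  generated_group [set s | exists i,
    reflection_at s (eq0_on (H i)) (L i `|` [set - l | l in L i])].

Definition tits_cone : set hdual :=
  \bigcup_(s in coxeter_group) [set s l | l in closed_chamber].

Record linear_coxeter_system : Prop := LinearCoxeterSystem {
  lcs_rank : (0 < n)%N;
  lcs_rayH : forall i, ray (H i);
  lcs_rayL : forall i, ray (L i);
  lcs_LH : forall i, L i `\ 0 `<=` gt0_on (H i);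
  lcs_span : is_span closed_chamber {:hdual}%VS;
  lcs_walls_inj : injective (fun i => closed_chamber `&` eq0_on (H i));
  lcs_walls :
    range (fun i => closed_chamber `&` eq0_on (H i)) =
    [set F | codim1_face closed_chamber F];
  lcs_disjoint : forall s, coxeter_group s -> s != \1%VF ->
    [set s l | l in chamber] `&` chamber = set0
}.

Definition Upsilon (Y : set hdual) : set (set hdual) :=
  [set F | Fa Y F /\ ri F `&` closed_chamber !=set0].

End LinearCoxeter.

(* Main.v *)
(** Existence: [ri F'] contains a point [w c] with [c] in the closed chamber,
    and [w^-1 F'] is the required face.

    Uniqueness: let [x], [y] be points of the closed chamber in the relative
    interiors of the faces [F1] and [F2 = w F1]. If [w <> 1], then [w C] lies
    strictly on the negative side of some wall [H_i]. The segment from [y] to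
    [w x] lies in [ri F2] and crosses this wall, at a point fixed by [s_i]; two
    faces whose relative interiors share a point coincide, so [s_i F2 = F2] and
    [F2 = (s_i w) F1]. Since [s_i w] is shorter than [w] by the exchange
    condition, induction on the length gives [F1 = F2]. *)

From HB Require Import structures.
Require Import Defs.
From mathcomp Require Import all_boot all_order all_algebra.
From mathcomp Require Import all_classical all_reals all_analysis.
From mathcomp Require Import lra ring.
Import Order.TTheory GRing.Theory Num.Theory.
Import numFieldNormedType.Exports.
Local Open Scope classical_set_scope.
Local Open Scope ring_scope.

Set Implicit Arguments.
Unset Strict Implicit.
Unset Printing Implicit Defensive.

(** * Relative interiors and faces of convex cones *)

Section RelativeInterior.
Variables (R : realType) (V : vectType R).
Implicit Types (K F : set V) (x y z v : V).

(** Turns the topology in [ri] into inequalities: balls of row vectors are those of the maximum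
    norm, and the topology is pulled back along [coords]. *)
Lemma nbhs_coordsP x (A : set V) :
  nbhs (x : initial_topology (@coords R V)) A <->
  exists2 e : R, 0 < e &
    forall y, (forall i, `|coord (vbasis {:V}) i (y - x)| < e) -> A y.
Proof.
have coordsB y i : coords x 0 i - coords y 0 i
                   = - coord (vbasis {:V}) i (y - x).
  by rewrite !mxE linearB opprB.
split=> [|[e e0 eA]].
  rewrite nbhsE => -[B [[D oD <-] Dx] sBA].
  have /nbhs_ballP[e /= e0 eD] : nbhs (coords x) D by apply: open_nbhs_nbhs.
  exists e => // y ye; apply: sBA => /=; apply: eD; split=> // i j.
  by rewrite [i]ord1 /ball /= coordsB normrN.
have : nbhs (x : initial_topology (@coords R V))
    (@coords R V @^-1` ball (coords x) e).
  by apply: (@initial_continuous _ _ (@coords R V) x); apply: nbhsx_ballx.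
apply: filterS => y /= [_ ye]; apply: eA => i.
by have := ye 0 i; rewrite /ball /= coordsB normrN.
Qed.

(** The algebraic relative interior, equal to [ri] for cones containing 0; it needs no topology and
    passes directly to linear images. *)
Definition cone_core K : set V :=
  [set x | K x /\ forall y, K y -> exists2 e : R, 0 < e & K (x - e *: y)].

Lemma cone_coreD K x y : cone K -> cone_core K x -> K y -> cone_core K (x + y).
Proof.
move=> [KD KZ] [Kx xK] Ky; split=> [|z /xK[e e0 Ke]]; first exact: KD.
by exists e => //; rewrite addrAC; apply: KD.
Qed.

Lemma cone_coreZ K (a : R) x : cone K -> 0 < a -> cone_core K x ->
  cone_core K (a *: x).
Proof.
move=> [KD KZ] a0 [Kx xK]; split=> [|z /xK[e e0 Ke]]; first exact: KZ.
exists (a * e); first exact: mulr_gt0.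
by rewrite -scalerA -scalerBr; apply: KZ.
Qed.

(** The weight [a] may vanish, as [x] alone provides interiority; this serves the point where a
    segment meets a wall. *)
Lemma cone_coreW K (a : R) x y : cone K -> K 0 -> 0 <= a -> cone_core K x ->
  K y -> cone_core K (a *: y + x).
Proof.
move=> cK K0 a0 xK Ky; rewrite addrC; apply: cone_coreD => //.
move: a0; rewrite le_eqVlt => /predU1P[<-|a0]; first by rewrite scale0r.
by apply: cK.2.
Qed.

Lemma cone_sum K (I : finType) (a : I -> R) (f : I -> V) :
  cone K -> K 0 -> (forall i, 0 <= a i) -> (forall i, K (f i)) ->
  K (\sum_i a i *: f i).
Proof.
move=> [KD KZ] K0 a0 Kf; elim/big_ind: _ => // i _.
have := a0 i; rewrite le_eqVlt => /predU1P[<-|ai]; first by rewrite scale0r.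
exact: KZ.
Qed.

(** Take a free family in [K] of maximal size: an element of [K] outside its span could be added to
    it. *)
Lemma free_spanning_seq K : exists X : seq V,
  [/\ free X, (forall i : 'I_(size X), K X`_i) &
      forall y, K y -> y \in <<X>>%VS].
Proof.
pose P m := `[< exists X : seq V,
  [/\ free X, (forall y, y \in X -> K y) & size X = m] >].
have P0 : exists m, P m.
    by exists 0; apply/asboolP; exists [::]; rewrite nil_free.
have Pb m : P m -> (m <= \dim {:V})%N.
  by move=> /asboolP[X [fX _ <-]]; rewrite -(eqP fX) dimvS // subvf.
case: (ex_maxnP P0 Pb) => m /asboolP[X [fX XK sX]] maxX.
exists X; split=> // [i|y Ky]; first by apply: XK; rewrite mem_nth.
apply/negPn/negP => yX; suff /maxX : P m.+1 by rewrite ltnn.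
apply/asboolP; exists (y :: X); split; rewrite ?free_cons ?yX //= ?sX // => z.
by rewrite inE => /predU1P[->//|/XK].
Qed.

(** The sum of a basis chosen inside [K] has all coordinates 1, so subtracting a small multiple of
    any [y] in [K] keeps them nonnegative. *)
Lemma cone_core_nonempty K : cone K -> K 0 -> cone_core K !=set0.
Proof.
move=> cK K0; have [X [fX XK spanX]] := free_spanning_seq K.
have sumX : K (\sum_(i < size X) X`_i).
  rewrite (eq_bigr (fun i : 'I__ => (1 : R) *: X`_i)) => [|i _]; last first.
    by rewrite scale1r.
  by apply: cone_sum.
exists (\sum_(i < size X) X`_i); split=> // y Ky.
pose c (i : 'I_(size X)) := coord (in_tuple X) i y.
pose e := (1 + \sum_i `|c i|)^-1.
have s0 : 0 <= \sum_i `|c i| by apply: sumr_ge0.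
have e0 : 0 < e by rewrite invr_gt0 ltr_pwDl.
exists e => //.
have /coord_span yE : y \in <<in_tuple X>>%VS by apply: spanX.
rewrite {1}yE scaler_sumr -sumrB (eq_bigr (fun i => (1 - e * c i) *: X`_i)).
  apply: cone_sum => // i; rewrite subr_ge0 mulrC ler_pdivrMr ?ltr_pwDl //.
  rewrite mul1r.
  apply: le_trans (ler_norm _) _; rewrite (bigD1 i) //=.
  have : 0 <= \sum_(j | j != i) `|c j| by apply: sumr_ge0.
  lra.
by move=> i _; rewrite scalerBl scale1r scalerA.
Qed.

(** The hull contains 0, hence the whole line through 0 and [y], also for negative [a]; the point is
    the midpoint of [x + x] and [(2 * a) *: y]. *)
Lemma affine_hull_cone K x y (a : R) : cone K -> K 0 -> K x -> K y ->
  affine_hull K (x + a *: y).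
Proof.
move=> [KD KZ] K0 Kx Ky A [affA KA].
have x2 := KA _ (KD _ _ Kx Kx).
have ay : A ((2 * a) *: y).
  by have := affA (2 * a) _ _ (KA _ K0) (KA _ Ky); rewrite scaler0 add0r.
have := affA 2^-1 _ _ x2 ay.
rewrite scalerA mulrA mulVf ?pnatr_eq0 // mul1r scalerDr -scalerDl.
by rewrite (_ : 1 - 2^-1 + (1 - 2^-1) = 1 :> R) ?scale1r //; lra.
Qed.

Lemma affine_hull_span K (X : seq V) : (forall y, K y -> y \in <<X>>%VS) ->
  forall y, affine_hull K y -> y \in <<X>>%VS.
Proof.
move=> KX y /(_ [set z | z \in <<X>>%VS]); apply; split=> // a u v /= uX vX.
by rewrite rpredD // rpredZ.
Qed.

(** A small step from [x] against [y] stays in the affine hull, so [ri] lies in the core.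
    Conversely, subtracting [e] times the sum of a basis inside [K] stays in [K]; this slack of [e]
    in each coordinate absorbs small perturbations. *)
Lemma ri_coneE K : cone K -> K 0 -> ri K = cone_core K.
Proof.
move=> cK K0; apply/seteqP; split=> x.
  case=> Kx; rewrite /within /= => /nbhs_coordsP[e e0 eK]; split=> // y Ky.
  pose s := \sum_i `|coord (vbasis {:V}) i y|.
  have s0 : 0 <= s by apply: sumr_ge0.
  pose d := e / (1 + s).
  have d0 : 0 < d by rewrite divr_gt0 // ltr_pwDl.
  exists d => //; apply: eK => [i|]; last first.
    by rewrite -scaleNr; apply: affine_hull_cone.
  rewrite addrAC subrr add0r linearN linearZ /= normrN normrM (gtr0_norm d0).
  rewrite /d mulrAC ltr_pdivrMr ?ltr_pwDl // ltr_pM2l //.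
  rewrite /s (bigD1 i) //=.
  have : 0 <= \sum_(j | j != i) `|coord (vbasis {:V}) j y| by apply: sumr_ge0.
  lra.
case=> Kx xK; split=> //; rewrite /within /=; apply/nbhs_coordsP.
have [X [fX XK spanX]] := free_spanning_seq K.
have [e e0 Ke] : exists2 e : R, 0 < e & K (x - e *: \sum_(i < size X) X`_i).
  apply: xK; rewrite (eq_bigr (fun i : 'I__ => (1 : R) *: X`_i)) => [|i _].
    by apply: cone_sum.
  by rewrite scale1r.
pose c (i : 'I_(size X)) y := coord (in_tuple X) i y.
(* [s] bounds the change from the basis of [V] to the family [X]: coordinates below [d] become
   coordinates of size at most [d * s <= e]. *)
pose s := \sum_i \sum_(j < \dim {:V}) `|c i (vbasis {:V})`_j|.
have s0 : 0 <= s by apply: sumr_ge0 => i _; apply: sumr_ge0.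
pose d := e / (1 + s).
have d0 : 0 < d by rewrite divr_gt0 // ltr_pwDl.
exists d => // y yd /(affine_hull_span spanX) yX.
have cle i : `|c i (y - x)| <= e.
  rewrite [y - x](coord_vbasis (memvf _)) /c linear_sum /=.
  apply: le_trans (ler_norm_sum _ _ _) _.
  apply: (@le_trans _ _ (d * s)); last first.
    rewrite /d -mulrA ger_pMr // mulrC ler_pdivrMr ?ltr_pwDl // mul1r; lra.
  rewrite /s (bigD1 i) //= mulrDr ler_wpDr //.
    apply: mulr_ge0; first exact: ltW.
    by apply: sumr_ge0 => j _; apply: sumr_ge0.
  rewrite mulr_sumr; apply: ler_sum => j _.
  by rewrite linearZ /= normrM ler_wpM2r // ltW.
have /coord_span yxE : y - x \in <<in_tuple X>>%VS.
  by rewrite rpredB //; apply: spanX.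
have -> : y = (x - e *: \sum_(i < size X) X`_i)
              + \sum_i (e + c i (y - x)) *: X`_i.
  under [X in _ + X]eq_bigr do rewrite scalerDl.
  by rewrite big_split /= -scaler_sumr -yxE addrA subrK addrC subrK.
apply: cK.1 => //; apply: cone_sum => // i.
by have := cle i; rewrite ler_norml => /andP[]; lra.
Qed.

Lemma Fa_cone K F : Fa K F -> cone F. Proof. by case. Qed.

Lemma Fa_sub K F : Fa K F -> F `<=` K. Proof. by case. Qed.

Lemma Fa_decomp K F x y : Fa K F -> K x -> K y -> F (x + y) -> F x.
Proof.
move=> [_ _ KF _] Kx Ky Fxy; apply: contrapT => Fx.
by have [] : (K `\` F) (x + y) by apply: KF; exists x => //; exists y.
Qed.

Lemma Fa0 K F : K 0 -> Fa K F -> F 0.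
Proof.
move=> K0 FF; have [x Fx] : F !=set0 by case: FF.
by apply: (Fa_decomp FF K0 (Fa_sub FF Fx)); rewrite add0r.
Qed.

(** [z] is the sum of [e *: y] and [z - e *: y], both in [K], so the face [F2] through [z] contains
    [e *: y], and hence [y]. *)
Lemma Fa_core_sub K F1 F2 z : cone K -> Fa K F1 -> Fa K F2 ->
  cone_core F1 z -> F2 z -> F1 `<=` F2.
Proof.
move=> cK FF1 FF2 [_ zF1] F2z y F1y; have [e e0 F1e] := zF1 _ F1y.
suff : F2 (e *: y).
  move=> /((Fa_cone FF2).2 e^-1); rewrite scalerA mulVf ?gt_eqF // scale1r.
  by apply; rewrite invr_gt0.
apply: (@Fa_decomp K F2 _ (z - e *: y) FF2); last by rewrite addrC subrK.
- by apply: cK.2 => //; apply: (Fa_sub FF1).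
- exact: (Fa_sub FF1).
Qed.

Lemma Fa_core_eq K F1 F2 z : cone K -> Fa K F1 -> Fa K F2 ->
  cone_core F1 z -> cone_core F2 z -> F1 = F2.
Proof.
move=> cK FF1 FF2 z1 z2; apply/seteqP; split.
  by apply: (Fa_core_sub cK FF1 FF2 z1); case: z2.
by apply: (Fa_core_sub cK FF2 FF1 z2); case: z1.
Qed.

Lemma cone_core_image K x (f : 'End(V)) : cone_core K x ->
  cone_core [set f y | y in K] (f x).
Proof.
move=> [Kx xK]; split=> [|_ [y /xK[e e0 Ke] <-]]; first by exists x.
exists e => //; exists (x - e *: y) => //.
by rewrite linearB linearZ.
Qed.

Lemma Fa_image K F (f : 'End(V)) : injective f -> [set f x | x in K] = K ->
  Fa K F -> Fa K [set f x | x in F].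
Proof.
move=> finj fK [[FD FZ] FK KF [x0 Fx0]]; split; last by exists (f x0), x0.
- split=> [_ _ [x Fx <-] [y Fy <-]|a _ a0 [x Fx <-]].
    by exists (x + y); rewrite ?linearD //; apply: FD.
  by exists (a *: x); rewrite ?linearZ //; apply: FZ.
- by move=> _ [x /FK Kx <-]; rewrite -fK; exists x.
move=> _ [x' [Kx' Fx']] [y' Ky'] <-; move: Kx' Ky' Fx'; rewrite -{1 2}fK.
move=> [x Kx <-] [y Ky <-] Fx; rewrite -linearD.
have Fx1 : ~ F x by move=> Fx1; apply: Fx; exists x.
have [Kxy Fxy] : (K `\` F) (x + y) by apply: KF; exists x => //; exists y.
split; first by rewrite -fK; exists (x + y).
by move=> [z Fz /finj zE]; apply: Fxy; rewrite -zE.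
Qed.

End RelativeInterior.

(** * Reflections and words in them *)

Section Reflections.
Variables (R : realType) (h : vectType R).
Local Notation hdual := 'Hom(h, R^o).
Variables (n : nat) (hv : 'I_n -> h) (lv : 'I_n -> hdual).
Implicit Types (i j k : 'I_n) (u v w : seq 'I_n) (x y z : hdual).

Definition ev i x : R := x (hv i).

Fact ev_is_scalar i : scalar (ev i).
Proof. by move=> a x y; rewrite /ev add_lfunE scale_lfunE. Qed.

HB.instance Definition _ i :=
  GRing.isLinear.Build R hdual R _ (ev i) (ev_is_scalar i).

(** The generators of the rays are not normalised to pair to 2, hence the division by
    [ev i (lv i)]. *)
Definition refl_fun i x : hdual := x - (2 * ev i x / ev i (lv i)) *: lv i.

Fact refl_fun_is_linear i : linear (refl_fun i).
Proof.
move=> a x y; rewrite /refl_fun linearP /= scalerBr addrACA -opprD scalerA.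
by rewrite -scalerDl mulrDr mulrDl !mulrA [2 * a]mulrC.
Qed.

HB.instance Definition _ i :=
  GRing.isLinear.Build R hdual hdual _ (refl_fun i) (refl_fun_is_linear i).

Definition refl i : 'End(hdual) := linfun (refl_fun i).

Definition word w : 'End(hdual) :=
  foldr (fun i f => (refl i \o f)%VF) \1%VF w.

Definition pos_chamber : set hdual := [set x | forall i, 0 < ev i x].

Definition nneg_chamber : set hdual := [set x | forall i, 0 <= ev i x].

Lemma reflE i x : refl i x = x - (2 * ev i x / ev i (lv i)) *: lv i.
Proof. by rewrite lfunE. Qed.

Lemma word_cons i w x : word (i :: w) x = refl i (word w x).
Proof. by rewrite /= comp_lfunE. Qed.

Lemma word_cat u v x : word (u ++ v) x = word u (word v x).
Proof.
by elim: u => [|i u IH]; rewrite ?cat_cons ?word_cons ?IH //= id_lfunE.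
Qed.

Lemma word_rcons u k x : word (rcons u k) x = word u (refl k x).
Proof. by rewrite -cats1 word_cat word_cons id_lfunE. Qed.

Hypothesis lv_gt0 : forall i, 0 < ev i (lv i).

Lemma ev_refl i x : ev i (refl i x) = - ev i x.
Proof.
rewrite reflE linearB linearZ /= divfK ?gt_eqF //; ring.
Qed.

Lemma refl_fix i x : ev i x = 0 -> refl i x = x.
Proof. by move=> x0; rewrite reflE x0 mulr0 mul0r scale0r subr0. Qed.

Lemma refl_lv i : refl i (lv i) = - lv i.
Proof.
by rewrite reflE mulfK ?gt_eqF // scaler_nat mulr2n opprD addrA subrr add0r.
Qed.

Lemma fix_refl i x : refl i x = x -> ev i x = 0.
Proof. by move=> /(congr1 (ev i)); rewrite ev_refl; lra. Qed.

Lemma reflK i : involutive (refl i).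
Proof.
move=> x; rewrite [in LHS]reflE ev_refl reflE mulrN mulNr scaleNr opprK.
by rewrite subrK.
Qed.

Lemma wordK w : cancel (word w) (word (rev w)).
Proof.
elim: w => [|i w IH] x; first by rewrite !id_lfunE.
by rewrite rev_cons word_rcons word_cons reflK IH.
Qed.

Lemma wordVK w : cancel (word (rev w)) (word w).
Proof. by move=> x; rewrite -{1}[w]revK wordK. Qed.

Lemma word_inv w : (word w)^-1%VF = word (rev w).
Proof.
have kw : lker (word w) == 0%VS by apply/lker0P; apply: (can_inj (wordK w)).
by apply/lfunP => x; rewrite -{1}[x](wordVK w) lker0_lfunK.
Qed.

(** * Chambers, walls and the exchange condition *)

Variables (c0 : hdual) (p : 'I_n -> hdual).
Hypothesis c0_pos : pos_chamber c0.
Hypothesis p_wall : forall k, ev k (p k) = 0.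
Hypothesis p_generic : forall k j, j != k -> 0 < ev j (p k).
Hypothesis chamber_disjoint : forall w x,
  pos_chamber x -> pos_chamber (word w x) -> word w = \1%VF.

Lemma refl_neq_id i : ~ (forall x, refl i x = x).
Proof. by move=> /(_ c0)/fix_refl c00; have := c0_pos i; rewrite c00 ltxx. Qed.

Lemma pos_chamberW x a y b : 0 < a -> pos_chamber x -> 0 <= b ->
  nneg_chamber y -> pos_chamber (a *: x + b *: y).
Proof.
move=> a0 x0 b0 y0 i; rewrite linearD !linearZ /=.
by apply: ltr_wpDr; [apply: mulr_ge0|apply: mulr_gt0].
Qed.

(* If s_i fixes w x, then w^-1 s_i w maps the point x of the open chamber to
   itself, so it is trivial. *)
Lemma word_wall w i x : pos_chamber x -> ev i (word w x) != 0.
Proof.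
move=> x0; apply/eqP => /refl_fix wx.
have w1 : word (rev w ++ i :: w) = \1%VF.
  by apply: (chamber_disjoint x0); rewrite word_cat word_cons wx wordK.
apply: (@refl_neq_id i) => y.
have := congr1 (fun f : 'End(hdual) => word w (f (word (rev w) y))) w1.
by rewrite word_cat word_cons !wordVK id_lfunE wordVK.
Qed.

(** Opposite signs at [c0] and [y] would let a positive combination of the two, still in the open
    chamber, land on the wall, against [word_wall]. *)
Lemma word_ge0 w i y : 0 < ev i (word w c0) -> nneg_chamber y ->
  0 <= ev i (word w y).
Proof.
move=> a0 y0; rewrite leNgt; apply/negP => b0.
have [] := eqVneq (ev i (word w (- ev i (word w y) *: c0
                                 + ev i (word w c0) *: y))) 0; last first.
  by move/eqP; apply; rewrite linearD !linearZ linearD !linearZ /=; ring.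
apply/eqP/word_wall; apply: pos_chamberW; rewrite ?ltW //; lra.
Qed.

Lemma word_le0 w i y : ev i (word w c0) < 0 -> nneg_chamber y ->
  ev i (word w y) <= 0.
Proof.
move=> a0 y0; rewrite -oppr_ge0 -ev_refl -word_cons; apply: word_ge0 => //.
by rewrite word_cons ev_refl oppr_gt0.
Qed.

(** Adding a large multiple of [p k] corrects the signs at all other walls and leaves the value at
    the k-th unchanged. Up to scaling, the new point is near [p k]. *)
Lemma pos_chamber_near k z : 0 < ev k z ->
  exists2 M : R, 0 < M & pos_chamber (z + M *: p k).
Proof.
move=> zk; pose M := 1 + \sum_(j | j != k) `|ev j z| / ev j (p k).
have t0 j : j != k -> 0 <= `|ev j z| / ev j (p k).
  by move=> jk; rewrite divr_ge0 // ltW // p_generic.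
have M0 : 0 < M by rewrite ltr_pwDl // sumr_ge0.
exists M => // j; rewrite linearD linearZ /=.
have [->|jk] := eqVneq j k; first by rewrite p_wall mulr0 addr0.
have : `|ev j z| < M * ev j (p k).
  rewrite -ltr_pdivrMr ?p_generic // /M (bigD1 j) //=.
  rewrite addrCA ltrDl ltr_pwDl // sumr_ge0 // => i /andP[ik _]; exact: t0.
by rewrite ltr_norml => /andP[]; lra.
Qed.

(* [u] and [u s_k] are adjacent chambers separated by the i-th wall. The image
   of the generic point [p k] of their common facet lies on that wall, so
   [t = u^-1 s_i u] fixes [p k]; near [p k] there are only two chambers, which
   forces [t = s_k]. *)
Lemma wall_crossing u k i y :
  0 < ev i (word u c0) -> ev i (word (rcons u k) c0) < 0 ->
  word u (refl k y) = refl i (word u y).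
Proof.
move=> u0 uk0.
have pk0 : nneg_chamber (p k).
  move=> j; have [->|jk] := eqVneq j k; first by rewrite p_wall.
  by rewrite ltW // p_generic.
have q0 : ev i (word u (p k)) = 0.
  have := word_ge0 u0 pk0; have := word_le0 uk0 pk0.
  by rewrite word_rcons (refl_fix (p_wall k)); lra.
pose t := rev u ++ i :: u.
have tp : word t (p k) = p k by rewrite word_cat word_cons refl_fix // wordK.
have tE x : refl i (word u x) = word u (word t x).
  by rewrite word_cat word_cons wordVK.
(* For large [M], both [c0 + M *: p k] and its image [word w c0 + M *: p k] lie in the open
   chamber. *)
have near_id w : word w (p k) = p k -> 0 < ev k (word w c0) -> word w = \1%VF.
  move=> wp /pos_chamber_near[M M0 Mpos].
  apply: (@chamber_disjoint _ (1 *: c0 + M *: p k)).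
    by apply: pos_chamberW => //; apply: ltW.
  by rewrite linearD !linearZ /= wp scale1r.
suff t1 : word (k :: t) = \1%VF.
  by rewrite tE -[word t y](reflK k) -word_cons t1 id_lfunE.
have := word_wall t k c0_pos; case: ltrgtP => // tk _.
  apply: near_id; first by rewrite word_cons tp refl_fix.
  by rewrite word_cons ev_refl oppr_gt0.
(* If [t] kept [c0] on the positive side of the k-th wall, [t] and with it [refl i] would be
   trivial. *)
case: (@refl_neq_id i) => x; have t1 := near_id _ tp tk.
by rewrite -[x](wordVK u) tE t1 id_lfunE.
Qed.

(** The chambers of the prefixes of [w] lead from the positive to the negative side of the i-th
    wall; at the letter that crosses it, [wall_crossing] lets [refl i] cancel that letter. *)
Lemma exchange w i : ev i (word w c0) < 0 ->
  exists2 w', (size w' < size w)%N & forall x, refl i (word w x) = word w' x.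
Proof.
(* [u] is the prefix already read, whose chamber is still on the positive side. *)
suff gen u v : 0 < ev i (word u c0) -> ev i (word (u ++ v) c0) < 0 ->
    exists2 w', (size w' < size (u ++ v))%N &
      forall x, refl i (word (u ++ v) x) = word w' x.
  by apply: (gen [::]); rewrite id_lfunE; apply: c0_pos.
elim: v u => [|k v IH] u u0; first by rewrite cats0; lra.
have := word_wall (rcons u k) i c0_pos.
case: (ltrgtP (ev i (word (rcons u k) c0)) 0) => // uk _ uv0.
  exists (u ++ v) => [|x]; first by rewrite !size_cat /= addnS.
  by rewrite !word_cat word_cons -(wall_crossing _ u0 uk) reflK.
by rewrite -cat_rcons; apply: IH => //; rewrite cat_rcons.
Qed.

(** The value 0 is excluded by [word_wall], so without a negative value [word w c0] would be back in
    the open chamber. *)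
Lemma descent w : word w != \1%VF -> exists i, ev i (word w c0) < 0.
Proof.
move=> w1; apply: contrapT => wpos; case/eqP: w1.
apply: (chamber_disjoint c0_pos) => i.
have := word_wall w i c0_pos; case: ltrgtP => // wi _.
by case: wpos; exists i.
Qed.

Lemma face_orbit_unique (Y F1 F2 : set hdual) w x y :
  cone Y -> Y 0 -> (forall v, [set word v z | z in Y] = Y) ->
  Fa Y F1 -> Fa Y F2 -> F2 = [set word w z | z in F1] ->
  cone_core F1 x -> nneg_chamber x -> cone_core F2 y -> nneg_chamber y ->
  F1 = F2.
Proof.
move=> cY Y0 wY FF1 FF2 F2E xF1 x0 yF2 y0.
have [m] := ubnP (size w); elim: m => // m IH in w F2E *; rewrite ltnS => wm.
have [w1|/descent[i wi]] := eqVneq (word w) \1%VF.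
  rewrite F2E w1; apply/seteqP; split=> [z Fz|_ [z Fz <-]].
    by exists z; rewrite ?id_lfunE.
  by rewrite id_lfunE.
have [w' ww' w'E] := exchange wi.
apply: (IH w'); last exact: leq_trans ww' wm.
have wxF2 : cone_core F2 (word w x) by rewrite F2E; apply: cone_core_image.
have wx0 := word_le0 wi x0.
have cF2 := Fa_cone FF2; have F20 := Fa0 Y0 FF2.
(* The segment from [y] to [w x] stays in the relative interior of [F2] and
   meets the i-th wall. *)
have [z zF2 zi] : exists2 z, cone_core F2 z & ev i z = 0.
  have := y0 i; rewrite le_eqVlt => /predU1P[yi|yi]; first by exists y.
  exists (- ev i (word w x) *: y + ev i y *: word w x).
    apply: cone_coreW => //; first by rewrite oppr_ge0.
      exact: cone_coreZ.
    by case: yF2.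
  by rewrite linearD !linearZ /=; ring.
have iF2 : Fa Y [set refl i z | z in F2].
  apply: Fa_image FF2; first exact: (can_inj (reflK i)).
  rewrite -[RHS](wY [:: i]); apply: eq_imagel => t _.
  by rewrite word_cons id_lfunE.
have <- : [set refl i z | z in F2] = F2.
  apply: (Fa_core_eq cY iF2 FF2 _ zF2).
  rewrite -[z in cone_core _ z](refl_fix zi).
  exact: cone_core_image.
by rewrite F2E image_comp; apply: eq_imagel => t _; rewrite /= w'E.
Qed.

End Reflections.

Lemma ray_generator (R : realType) (V : lmodType R) (v : V) :
  [set a *: v | a in [set a : R | 0 <= a]] v.
Proof. by exists 1; [exact: ler01|rewrite scale1r]. Qed.

(** * Chamber, group and walls from the axioms of a linear Coxeter system *)

Section CoxeterGroup.
Variables (R : realType) (h : vectType R).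
Local Notation hdual := 'Hom(h, R^o).
Variables (n : nat) (H : 'I_n -> set h) (L : 'I_n -> set hdual).
Variables (hv : 'I_n -> h) (lv : 'I_n -> hdual).
Hypothesis HE : forall i, H i = [set a *: hv i | a in [set a : R | 0 <= a]].
Hypothesis LE : forall i, L i = [set a *: lv i | a in [set a : R | 0 <= a]].
Hypothesis lv_gt0 : forall i, 0 < ev hv i (lv i).

Lemma eq0_onE i : eq0_on (H i) = [set x | ev hv i x = 0].
Proof.
rewrite HE; apply/seteqP; split=> x /=; first by apply; apply: ray_generator.
by move=> xi _ [a _ <-]; rewrite linearZ /= [x _]xi scaler0.
Qed.

Lemma hv_neq0 i : hv i != 0.
Proof. by apply/eqP => h0; have := lv_gt0 i; rewrite /ev h0 linear0 ltxx. Qed.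

Lemma closed_chamberE : closed_chamber H = nneg_chamber hv.
Proof.
apply/seteqP; split=> x xC i.
  by apply: (xC i I); rewrite HE; apply: ray_generator.
move=> _ v; rewrite HE => -[a /= a0 <-].
by rewrite linearZ /=; apply: mulr_ge0 => //; apply: xC.
Qed.

Lemma chamberE : chamber H = pos_chamber hv.
Proof.
apply/seteqP; split=> x xC i.
  by apply: (xC i I); rewrite ?hv_neq0 // HE; apply: ray_generator.
move=> _ v; rewrite HE => -[a /= a0 <-].
rewrite scaler_eq0 negb_or => /andP[an0 _].
by rewrite linearZ /=; apply: mulr_gt0; [rewrite lt0r an0|apply: xC].
Qed.

(** Every [x] splits into a vector of the hyperplane and a multiple of [lv i], so the two conditions
    leave one choice for [s]. *)
Lemma reflection_atE i (s : 'End(hdual)) :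
  reflection_at s (eq0_on (H i)) (L i `|` [set - l | l in L i]) <->
  s = refl hv lv i.
Proof.
rewrite eq0_onE LE; split=> [[fixs negs]|->].
  have sl : s (lv i) = - lv i.
    by apply: negs; left; apply: ray_generator.
  apply/lfunP => x; rewrite reflE.
  set c := ev hv i x / ev hv i (lv i).
  have -> : 2 * ev hv i x / ev hv i (lv i) = c + c.
    by rewrite /c -mulrDl; congr (_ / _); ring.
  have -> : s x = s (x - c *: lv i) + c *: s (lv i).
    by rewrite -linearZ -linearD subrK.
  rewrite sl fixs; last first.
    by rewrite /= linearB linearZ /= /c divfK ?subrr // gt_eqF.
  by rewrite scalerN scalerDl opprD addrA.
split=> [x|x]; first exact: refl_fix.
have neg a : refl hv lv i (a *: lv i) = - (a *: lv i).
  by rewrite linearZ /= refl_lv // scalerN.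
by move=> [[a _ <-]|[_ [a _ <-] <-]]; rewrite ?neg // -scaleNr neg.
Qed.

(** Reflections are involutions, so reversed words are inverses and the words already form a
    group. *)
Lemma coxeter_groupE : coxeter_group H L = range (word hv lv).
Proof.
rewrite /coxeter_group; apply/seteqP; split=> [s|_ [w _ <-]].
  apply; split.
    split=> [|_ _ [u _ <-] [v _ <-]|_ [w _ <-]|_ [w _ <-]].
    - by exists [::].
    - by exists (u ++ v) => //; apply/lfunP => x; rewrite word_cat comp_lfunE.
    - by exists (rev w) => //; rewrite word_inv.
    - by apply/lker0P/(can_inj (wordK lv_gt0 w)).
  move=> _ [i /reflection_atE ->]; exists [:: i] => //.
  by apply/lfunP => x; rewrite word_cons id_lfunE.
move=> G [[G1 GM _ _] SG]; elim: w => [|i w IH] //=.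
by apply: GM IH; apply: SG; exists i; apply/reflection_atE.
Qed.

Hypothesis HL : linear_coxeter_system H L.

(** If [ev hv i] vanished on the whole closed chamber, which spans the dual space, [refl hv lv i]
    would fix everything, even [lv i]. Summing one witness per [i] gives the point. *)
Lemma pos_chamber_nonempty : pos_chamber hv !=set0.
Proof.
have /choice[c cP] i : exists c, nneg_chamber hv c /\ 0 < ev hv i c.
  apply: contrapT => noc.
  have /(lcs_span HL).2 sub x : closed_chamber H x ->
      x \in fixedSpace (refl hv lv i).
    rewrite closed_chamberE => x0; apply/fixedSpaceP/refl_fix.
    have := x0 i; rewrite le_eqVlt => /predU1P[//|xi].
    by case: noc; exists x.
  have /fixedSpaceP/(fix_refl lv_gt0) li := subvP sub _ (memvf (lv i)).
  by have := lv_gt0 i; rewrite li ltxx.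
exists (\sum_i c i) => i; rewrite linear_sum /= (bigD1 i) //= ltr_pwDl //.
  by case: (cP i).
by apply: sumr_ge0 => j _; case: (cP j).
Qed.

(** As no facet contains another, each [j != k] has a point of the k-th facet off the j-th wall; the
    sum of these points is generic. *)
Lemma wall_generic k : exists p : hdual,
  ev hv k p = 0 /\ forall j, j != k -> 0 < ev hv j p.
Proof.
pose F i := closed_chamber H `&` eq0_on (H i).
have Fcodim i : codim1_face (closed_chamber H) (F i).
  by have : range F (F i) by []; rewrite (lcs_walls HL).
(* Facets have equal dimension, so an inclusion makes their spans equal; [ev hv k] then vanishes on
   [F j], which gives the reverse inclusion. *)
have Fsub j : F k `<=` F j -> j = k.
  move=> Fkj; apply/esym/(lcs_walls_inj HL); apply/seteqP; split=> // x Fjx.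
  have [_ [Uk [U [[Uk1 Uk2] [U1 U2] dk]]]] := Fcodim k.
  have [_ [Uj [U' [[Uj1 Uj2] [U'1 U'2] dj]]]] := Fcodim j.
  have UU : U = U' by apply/eqP; rewrite eqEsubv U2 //= U'2.
  have Ukj : Uk = Uj.
    apply/eqP; rewrite eqEdim Uk2 /= => [|y /Fkj/Uj1 //].
    by rewrite -ltnS dk dj UU.
  have fixk : (Uk <= fixedSpace (refl hv lv k))%VS.
    by apply: Uk2 => y [_]; rewrite eq0_onE => yk; apply/fixedSpaceP/refl_fix.
  split; first by case: Fjx.
  rewrite eq0_onE; apply: (fix_refl lv_gt0); apply/fixedSpaceP.
  by apply: (subvP fixk); rewrite Ukj; apply: Uj1.
have /choice[q qP] j : exists q,
    [/\ nneg_chamber hv q, ev hv k q = 0 & j != k -> 0 < ev hv j q].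
  have [->|/eqP jk] := eqVneq j k.
    by exists 0; split=> [i||]; rewrite ?linear0 ?eqxx.
  apply: contrapT => noq; apply: jk; apply: Fsub => x [xC xk]; split=> //.
  move: xC xk; rewrite closed_chamberE !eq0_onE /= => x0 xk.
  have := x0 j; rewrite le_eqVlt => /predU1P[//|xj].
  by case: noq; exists x.
exists (\sum_j q j); split=> [|j jk]; rewrite linear_sum /=.
  by apply: big1 => j _; case: (qP j).
rewrite (bigD1 j) //= ltr_pwDl //; first by case: (qP j) => _ _; apply.
by apply: sumr_ge0 => i _; case: (qP i).
Qed.

End CoxeterGroup.

Unset Implicit Arguments.

Theorem corollary4p10 (R : realType) (h : vectType R) (n : nat)
    (H : 'I_n -> set h) (L : 'I_n -> set 'Hom(h, R^o))
    (Y F' : set 'Hom(h, R^o)) :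
  linear_coxeter_system H L ->
  Y `<=` tits_cone H L ->
  cone Y ->
  Y 0 ->
  (forall s, coxeter_group H L s -> [set s l | l in Y] = Y) ->
  Fa Y F' ->
  exists! F : set 'Hom(h, R^o),
    Upsilon H Y F /\
    exists2 s, coxeter_group H L s & F' = [set s l | l in F].
Proof.
move=> HL YX cY Y0 WY FF'.
have /choice[hv HE] i : exists v,
    H i = [set a *: v | a in [set a : R | 0 <= a]].
  by have [v _ ->] := lcs_rayH HL i; exists v.
have /choice[lv lvP] i : exists v,
    L i = [set a *: v | a in [set a : R | 0 <= a]] /\ 0 < ev hv i v.
  have [v v0 LE] := lcs_rayL HL i; exists v; split=> //.
  have [w w0 HE'] := lcs_rayH HL i.
  apply: (@lcs_LH _ _ _ _ _ HL i v).
  - by split; [rewrite LE; apply: ray_generator|apply/eqP].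
  - by rewrite HE; apply: ray_generator.
  (* The generator [hv i] is nonzero: otherwise [H i] would reduce to 0, although it contains
     [w]. *)
  apply: contraNneq w0 => h0.
  have : H i w by rewrite HE'; apply: ray_generator.
  by rewrite HE h0 => -[a _ <-]; rewrite scaler0.
have LE i := (lvP i).1; have lv_gt0 i := (lvP i).2.
have GE := coxeter_groupE HE LE lv_gt0.
have CE := closed_chamberE HE.
have [c0 c0_pos] := pos_chamber_nonempty HE lv_gt0 HL.
have [p pP] := choice (wall_generic HE lv_gt0 HL).
have disj w x : pos_chamber hv x -> pos_chamber hv (word hv lv w x) ->
    word hv lv w = \1%VF.
  move=> x0 wx0; apply/eqP; apply: contrapT => /negP w1.
  suff : set0 (word hv lv w x) by [].
  rewrite -(lcs_disjoint HL _ w1); last by rewrite GE; exists w.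
  by rewrite (chamberE HE lv_gt0); split=> //; exists x.
have wY w : [set word hv lv w x | x in Y] = Y.
  by apply: WY; rewrite GE; exists w.
have wFa w F : Fa Y F -> Fa Y [set word hv lv w x | x in F].
  by apply: Fa_image => //; apply: (can_inj (wordK lv_gt0 w)).
have imK w F :
    [set word hv lv w x | x in [set word hv lv (rev w) x | x in F]] = F.
  rewrite image_comp -[RHS]image_id; apply: eq_imagel => x _ /=.
  exact: wordVK.
have riE F : Fa Y F -> ri F = cone_core F.
  by move=> FF; apply: ri_coneE; [apply: Fa_cone FF|apply: Fa0 FF].
have [x xF'] := cone_core_nonempty (Fa_cone FF') (Fa0 Y0 FF').
have [s Gs [c cC scx]] : tits_cone H L x.
  by apply/YX/(Fa_sub FF'); case: xF'.
have [w wcx] : exists w, word hv lv w c = x.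
  by move: Gs; rewrite GE => -[w _ ws]; exists w; rewrite ws.
have FF := wFa (rev w) _ FF'.
have cF : cone_core [set word hv lv (rev w) y | y in F'] c.
  by rewrite -(wordK lv_gt0 w c) wcx; apply: cone_core_image.
exists [set word hv lv (rev w) y | y in F']; split=> [|F2 [[FF2 [y []]]]].
  split; last by rewrite GE; exists (word hv lv w); rewrite ?imK.
  by split=> //; exists c; split=> //; rewrite riE.
rewrite riE // CE => yF2 y0 [s']; rewrite GE => -[v _ <-] F'E.
apply/esym; rewrite CE in cC.
have same := face_orbit_unique lv_gt0 c0_pos (fun k => (pP k).1)
  (fun k j => (pP k).2 j) disj cY Y0 wY FF2 FF.
(* Since [F'] is the image of [F2] under [v], the face built from [F'] is the image of [F2] under
   [rev w ++ v]. *)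
apply: (same (rev w ++ v) y c) => //.
by rewrite F'E image_comp; apply: eq_imagel => z _; rewrite /= word_cat.
Qed.
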